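(* Let $n\ge 2$ and let $P=(p_1,\dots,p_n)$, $Q=(q_1,\dots,q_n)$ be probability distributions with all $p_i>0$, $q_i>0$ and $\sum_i p_i=\sum_i q_i=1$. With the differences $D_{K_0B}=D_{K_0B}(P\|Q)$ defined in the context, $$D_{K_0T}\le D_{K_0J}\le D_{K_0M_3}\le D_{K_0h}\le D_{K_0M_2}\le D_{K_0M_1}\le D_{K_0I}\le D_{K_0\Delta}$$ and $$D_{K_0\Delta}\le \tfrac32 D_{K_0I}\le \tfrac85 D_{K_0M_1}\le \tfrac{24}{13}D_{K_0M_2}\le 2D_{K_0h},$$ $$2D_{K_0h}\le 3D_{K_0J},\qquad 2D_{K_0h}\le \tfrac83 D_{K_0M_3}.$$
   Context: For $P,Q$ as in the claim define (all sums over $i=1,\dots,n$): $\Delta=\sum \frac{(p_i-q_i)^2}{p_i+q_i}$; $I=\frac12\left[\sum p_i\ln\frac{2p_i}{p_i+q_i}+\sum q_i\ln\frac{2q_i}{p_i+q_i}\right]$; $M_1=\sum\left[\sqrt{\frac{p_i+q_i}{2}}\,\frac{\sqrt{p_i}+\sqrt{q_i}}{2}-\left(\frac{\sqrt{p_i}+\sqrt{q_i}}{2}\right)^2\right]$; $M_2=\sum\left[\frac{\sqrt{p_i}+\sqrt{q_i}}{2}\sqrt{\frac{p_i+q_i}{2}}-\sqrt{p_iq_i}\right]$; $h=\frac12\sum(\sqrt{p_i}-\sqrt{q_i})^2$; $M_3=\sum\left[\frac{p_i+q_i}{2}-\frac{\sqrt{p_i}+\sqrt{q_i}}{2}\sqrt{\frac{p_i+q_i}{2}}\right]$;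 $J=\sum(p_i-q_i)\ln\frac{p_i}{q_i}$; $T=\sum\frac{p_i+q_i}{2}\ln\frac{p_i+q_i}{2\sqrt{p_iq_i}}$; $K_0=\sum\frac{(p_i-q_i)^2}{\sqrt{p_iq_i}}$. Associate to these symbols the normalized quantities $\bar\Delta=\frac14\Delta$, $\bar I=I$, $\bar M_1=4M_1$, $\bar M_2=\frac43M_2$, $\bar h=h$, $\bar M_3=4M_3$, $\bar J=\frac18J$, $\bar T=T$, $\bar K_0=\frac18K_0$. For two symbols $A,B$ put $D_{AB}=D_{AB}(P\|Q):=\bar A-\bar B$; e.g. $D_{K_0I}=\frac18K_0-I$, $D_{K_0J}=\frac18K_0-\frac18J$. *)

(* Defs.v *)
From mathcomp Require Import all_boot all_order all_algebra.
From mathcomp Require Import reals exp.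

Set Implicit Arguments.
Unset Strict Implicit.
Unset Printing Implicit Defensive.

Import Order.TTheory GRing.Theory Num.Theory.
Local Open Scope ring_scope.

Definition positive_distribution (R : realType) (n : nat) (P : 'I_n -> R) :
    Prop :=
  (forall i, 0 < P i) /\ \sum_(i < n) P i = 1.

Section Divergences.
Variables (R : realType) (n : nat).
Implicit Types P Q : 'I_n -> R.

Definition triangular_discrimination P Q : R :=
  \sum_(i < n) (P i - Q i) ^+ 2 / (P i + Q i).

Definition jensen_shannon P Q : R :=
  2^-1 * (\sum_(i < n) P i * ln (2 * P i / (P i + Q i))
          + \sum_(i < n) Q i * ln (2 * Q i / (P i + Q i))).

Definition mean_divergence1 P Q : R :=
  \sum_(i < n)
    (Num.sqrt ((P i + Q i) / 2) * ((Num.sqrt (P i) + Num.sqrt (Q i)) / 2)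
     - ((Num.sqrt (P i) + Num.sqrt (Q i)) / 2) ^+ 2).

Definition mean_divergence2 P Q : R :=
  \sum_(i < n)
    ((Num.sqrt (P i) + Num.sqrt (Q i)) / 2 * Num.sqrt ((P i + Q i) / 2)
     - Num.sqrt (P i * Q i)).

Definition hellinger P Q : R :=
  2^-1 * \sum_(i < n) (Num.sqrt (P i) - Num.sqrt (Q i)) ^+ 2.

Definition mean_divergence3 P Q : R :=
  \sum_(i < n)
    ((P i + Q i) / 2
     - (Num.sqrt (P i) + Num.sqrt (Q i)) / 2 * Num.sqrt ((P i + Q i) / 2)).

Definition jeffreys P Q : R :=
  \sum_(i < n) (P i - Q i) * ln (P i / Q i).

Definition arith_geom_divergence P Q : R :=
  \sum_(i < n)
    (P i + Q i) / 2 * ln ((P i + Q i) / (2 * Num.sqrt (P i * Q i))).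

Definition K0_divergence P Q : R :=
  \sum_(i < n) (P i - Q i) ^+ 2 / Num.sqrt (P i * Q i).

End Divergences.

Inductive divergence_symbol : Set :=
  sDelta | sI | sM1 | sM2 | sh | sM3 | sJ | sT | sK0.

(* The constants make all nine divergences agree to second order at P = Q. *)
Definition normalized (R : realType) (n : nat) (A : divergence_symbol)
    (P Q : 'I_n -> R) : R :=
  match A with
  | sDelta => 1 / 4 * triangular_discrimination P Q
  | sI => jensen_shannon P Q
  | sM1 => 4 * mean_divergence1 P Q
  | sM2 => 4 / 3 * mean_divergence2 P Q
  | sh => hellinger P Q
  | sM3 => 4 * mean_divergence3 P Q
  | sJ => 1 / 8 * jeffreys P Q
  | sT => arith_geom_divergence P Q
  | sK0 => 1 / 8 * K0_divergence P Q
  end.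

Definition divergence_diff (R : realType) (n : nat) (A B : divergence_symbol)
    (P Q : 'I_n -> R) : R :=
  normalized A P Q - normalized B P Q.

(* Main.v *)
Require Import Defs.
From mathcomp Require Import all_boot all_order all_algebra.
From mathcomp Require Import reals exp.
From mathcomp Require Import normedtype derive realfun trigo.
From mathcomp Require Import ring lra.

(* All the divergences are sums of functions of (p_i, q_i) that are symmetric
   and homogeneous of degree 1, so it suffices to compare summands with q <= p
   and p + q = 2. Write sqrt p = cos x + sin x and sqrt q = cos x - sin x with
   0 <= x < pi / 4. The mean of the square roots is then cos x, the geometric
   mean is c = cos 2x, and p - q = 2 sin 2x. With L = ln (p / q), whose
   derivative is 4 / c, the logarithmic summands are J/8 = L sin 2x / 4,
   T = - ln c and I = L sin 2x / 2 + ln c; moreover I' = c L and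
   T' = 2 sin 2x / c. An inequality that involves T or I reduces, after one
   differentiation, to a comparison of L with an algebraic function of cos x
   and sin x; after a second one only a polynomial inequality in cos x, with a
   factor 1 - cos x or 1 - c, remains. *)

Set Implicit Arguments.
Unset Strict Implicit.
Unset Printing Implicit Defensive.

Import Order.TTheory GRing.Theory Num.Theory numFieldNormedType.Exports.
Local Open Scope ring_scope.

(* Unlike [is_derive], not a type class: side conditions stay as subgoals. *)
Definition has_deriv (R : realType) (f : R -> R) (x d : R) : Prop :=
  is_derive x 1 f d.

(** * Differentiation rules in relational form *)

Section DerivativeRules.
Variables (R : realType) (x : R).
Implicit Types (f g : R -> R) (df dg : R).

(** Lets the rules build a derivative by unification and leaves its agreement with the intended
    formula to [ring] or [field]. *)
Lemma has_deriv_eq f d d' : has_deriv f x d -> d = d' -> has_deriv f x d'.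
Proof. by move=> h <-. Qed.

Lemma has_deriv_cst (k : R) : has_deriv (fun=> k) x 0.
Proof. exact: is_derive_cst. Qed.

Lemma has_deriv_cos : has_deriv (@cos R) x (- sin x).
Proof. exact: is_derive_cos. Qed.

Lemma has_deriv_sin : has_deriv (@sin R) x (cos x).
Proof. exact: is_derive_sin. Qed.

Lemma has_derivD f g df dg : has_deriv f x df -> has_deriv g x dg ->
  has_deriv (fun y => f y + g y) x (df + dg).
Proof. by move=> hf hg; exact: is_deriveD. Qed.

Lemma has_derivN f df : has_deriv f x df -> has_deriv (fun y => - f y) x (- df).
Proof. by move=> hf; exact: is_deriveN. Qed.

Lemma has_derivM f g df dg : has_deriv f x df -> has_deriv g x dg ->
  has_deriv (fun y => f y * g y) x (f x * dg + g x * df).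
Proof. by move=> hf hg; exact: is_deriveM. Qed.

Lemma has_derivX f df n : has_deriv f x df ->
  has_deriv (fun y => f y ^+ n) x (n%:R * f x ^+ n.-1 * df).
Proof.
move=> hf; elim: n => [|n IH].
  by rewrite !mul0r; exact: has_deriv_cst.
rewrite (_ : (fun y => _) = fun y => f y * f y ^+ n); last first.
  by apply: boolp.funext => y; rewrite exprS.
apply: (has_deriv_eq (has_derivM hf IH)).
(* At [n = 0] the truncated exponent [n.-1] breaks [f x * f x ^+ n.-1 = f x ^+ n], but the
   coefficient [n%:R] is then zero. *)
by case: n {IH} => [|n] /=; rewrite ?exprS -?natr1; ring.
Qed.

Lemma has_derivV f df : f x != 0 -> has_deriv f x df ->
  has_deriv (fun y => (f y)^-1) x (- (f x ^- 2 * df)).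
Proof.
move=> fx hf; rewrite -mulNr; exact: is_deriveV fx hf.
Qed.

Lemma has_deriv_ln f df : 0 < f x -> has_deriv f x df ->
  has_deriv (fun y => ln (f y)) x ((f x)^-1 * df).
Proof. by move=> fx hf; exact: is_derive1_comp (is_derive1_ln fx) hf. Qed.

End DerivativeRules.

Ltac derive_rule := first
  [ exact: has_deriv_cos | exact: has_deriv_sin | exact: has_deriv_cst
  | apply: has_derivD | apply: has_derivN | apply: has_derivX
  | apply: has_derivM | apply: has_derivV | apply: has_deriv_ln ].

(** * The angle x and the functions of 2x *)

Section QuarterAngle.
Variable R : realType.
Implicit Types x y : R.

(** A function with nonnegative derivative is nondecreasing. The derivative is existential so that
    [eexists] can have it computed by the rules and then rewritten in a form of visible sign. *)
Lemma nonneg_of_derive (f : R -> R) : f 0 = 0 ->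
  (forall y, 0 <= y < pi / 4 -> exists2 d, has_deriv f y d & 0 <= d) ->
  forall x, 0 <= x < pi / 4 -> 0 <= f x.
Proof.
move=> f0 hf x /andP[x0 xpi].
have dom y : y \in `[0, x] -> 0 <= y < pi / 4.
  by rewrite in_itv /= => /andP[-> /le_lt_trans]; exact.
have der y : y \in `[0, x] -> derivable f y 1.
  by move=> /dom /hf [d [? _] _].
rewrite -f0; apply: (@ger0_derive1_ndecr R f 0 x) => //.
- by move=> y hy; apply: der; exact: subset_itv_oo_cc hy.
- move=> y hy; have [d [_ hd] d0] := hf y (dom y (subset_itv_oo_cc hy)).
  by rewrite derive1E hd.
- by apply: derivable_within_continuous.
Qed.

Definition cos_dbl x : R := cos x ^+ 2 - sin x ^+ 2.
Definition sin_dbl x : R := 2 * sin x * cos x.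
(** This is ln (p / q) for p = (cos x + sin x)^2 and q = (cos x - sin x)^2. *)
Definition logratio x : R := 2 * (ln (cos x + sin x) - ln (cos x - sin x)).

Lemma quarter_angle_bounds x : 0 <= x < pi / 4 ->
  [/\ 0 < cos x, 0 <= sin x, 0 < cos x - sin x & 0 < cos_dbl x].
Proof.
move=> /andP[x0 x1]; have pi0 := pi_gt0 R.
have c0 : 0 < cos x by apply: cos_gt0_pihalf; apply/andP; split; lra.
have s0 : 0 <= sin x by apply: sin_ge0_pi; apply/andP; split; lra.
have : 0 < cos (x *+ 2) by apply: cos_gt0_pihalf; apply/andP; split; lra.
have := cos2Dsin2 x; rewrite cos_mulr2n => e h.
have d0 : 0 < cos_dbl x by rewrite /cos_dbl; lra.
(* If cos x <= sin x, squaring contradicts cos x ^+ 2 > sin x ^+ 2. *)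
split=> //; rewrite ltNge; apply/negP=> k; move: d0; rewrite /cos_dbl; nra.
Qed.

Lemma cos_dblE x : cos_dbl x = 2 * cos x ^+ 2 - 1.
Proof. by rewrite /cos_dbl sin2cos2; ring. Qed.

Lemma sin_dbl_sqr x : sin_dbl x ^+ 2 = 1 - cos_dbl x ^+ 2.
Proof. by rewrite cos_dblE /sin_dbl !exprMn sin2cos2; ring. Qed.

Lemma has_deriv_cos_dbl x : has_deriv cos_dbl x (- 2 * sin_dbl x).
Proof.
apply: has_deriv_eq; first by rewrite /cos_dbl; repeat derive_rule.
by rewrite /sin_dbl /=; ring.
Qed.

Lemma has_deriv_sin_dbl x : has_deriv sin_dbl x (2 * cos_dbl x).
Proof.
apply: has_deriv_eq; first by rewrite /sin_dbl; repeat derive_rule.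
by rewrite /cos_dbl /=; ring.
Qed.

Lemma has_deriv_logratio x : 0 <= x < pi / 4 ->
  has_deriv logratio x (4 / cos_dbl x).
Proof.
move=> /quarter_angle_bounds[c0 s0 d0 e0].
have a0 : 0 < cos x + sin x by rewrite ltr_wpDr.
apply: has_deriv_eq; first by rewrite /logratio; repeat derive_rule.
have r2 := sin2cos2 x.
have -> : cos_dbl x = (cos x + sin x) * (cos x - sin x).
  by rewrite /cos_dbl; ring.
by field: r2; rewrite !gt_eqF.
Qed.

End QuarterAngle.

(* The specific rules come first: the generic ones would unfold [cos_dbl],
   [sin_dbl] and [logratio]. *)
Ltac derive_dbl_rule hy := first
  [ exact: has_deriv_cos_dbl | exact: has_deriv_sin_dbl
  | exact: (has_deriv_logratio hy) | derive_rule ].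

(** * Algebraic bounds on the log ratio *)

Section LogRatioBounds.
Variable R : realType.
Implicit Types x y : R.

Lemma logratio0 : logratio (0 : R) = 0.
Proof. by rewrite /logratio cos0 sin0 addr0 subr0 subrr mulr0. Qed.

Lemma cos_dbl0 : cos_dbl (0 : R) = 1.
Proof. by rewrite /cos_dbl cos0 sin0; ring. Qed.

Lemma sin_dbl0 : sin_dbl (0 : R) = 0.
Proof. by rewrite /sin_dbl sin0; ring. Qed.

Definition at0 := (logratio0, cos_dbl0, sin_dbl0, @cos0 R, @sin0 R).

(** Up to the factor [cos_dbl x / 2], this is the derivative of T - J for the normalized
    summands. *)
Lemma logratio_le_T_bound x : 0 <= x < pi / 4 ->
  0 <= 2 * sin_dbl x / cos_dbl x ^+ 2 - logratio x.
Proof.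
move: x; apply: nonneg_of_derive => [|y hy].
  by rewrite !at0; field.
have [s0 r0 d0 c0] := quarter_angle_bounds hy.
have cn := lt0r_neq0 c0; have sn := lt0r_neq0 s0.
eexists; first by repeat derive_dbl_rule hy; rewrite /= ?expf_neq0 ?mulf_neq0.
rewrite [leRHS](_ : _ = 8 * sin_dbl y ^+ 2 / cos_dbl y ^+ 3) /=; last by field.
by rewrite divr_ge0 ?mulr_ge0 ?exprn_ge0 // ?ltW.
Qed.

(** Multiplying by sin x cos x gives twice J - M3 of the normalized summands, so this comparison
    takes a single differentiation. *)
Lemma logratio_ge_M3_bound x : 0 <= x < pi / 4 ->
  0 <= logratio x - 8 * (sin x / (cos x * (1 + cos x))).
Proof.
move: x; apply: nonneg_of_derive => [|y hy].
  by rewrite !at0; field.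
have [s0 r0 d0 c0] := quarter_angle_bounds hy.
have cn := lt0r_neq0 c0; have sn := lt0r_neq0 s0.
have r2 := sin2cos2 y; have cE := cos_dblE y; have s1 := cos_le1 y.
have sp : 1 + cos y != 0 by rewrite gt_eqF // addr_gt0.
eexists; first by repeat derive_dbl_rule hy; rewrite /= ?expf_neq0 ?mulf_neq0.
rewrite [leRHS](_ : _ = 4 *
  ((1 - cos y) * (4 * cos y * (1 - cos y ^+ 2) + 2 - cos y ^+ 2))
  / (cos y ^+ 2 * (1 + cos y) * cos_dbl y)) /=; last first.
  by field: r2 cE; rewrite cn sn sp.
rewrite divr_ge0 ?mulr_ge0 ?exprn_ge0 ?subr_ge0 ?addr_ge0 // ?ltW //; nra.
Qed.

(** Up to the factor [cos_dbl x], this is the derivative of M1 - I for the normalized summands. *)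
Lemma logratio_le_M1_bound x : 0 <= x < pi / 4 ->
  0 <= 4 * (sin x * (2 * cos x - 1)) / cos_dbl x - logratio x.
Proof.
move: x; apply: nonneg_of_derive => [|y hy].
  by rewrite !at0; field.
have [s0 r0 d0 c0] := quarter_angle_bounds hy.
have cn := lt0r_neq0 c0; have sn := lt0r_neq0 s0.
have r2 := sin2cos2 y; have cE := cos_dblE y; have s1 := cos_le1 y.
eexists; first by repeat derive_dbl_rule hy; rewrite /= ?expf_neq0 ?mulf_neq0.
rewrite [leRHS](_ : _ = 4 * ((1 - cos y) * (3 - 2 * cos y ^+ 2))
  / cos_dbl y ^+ 2) /=; last by rewrite /sin_dbl; field: r2 cE.
rewrite divr_ge0 ?mulr_ge0 ?exprn_ge0 ?subr_ge0 // ?ltW //; nra.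
Qed.

Lemma logratio_ge_Delta_bound x : 0 <= x < pi / 4 ->
  0 <= logratio x - 2 * sin_dbl x.
Proof.
move: x; apply: nonneg_of_derive => [|y hy].
  by rewrite !at0; field.
have [s0 r0 d0 c0] := quarter_angle_bounds hy.
have cn := lt0r_neq0 c0; have sn := lt0r_neq0 s0.
have r2 := sin2cos2 y; have cE := cos_dblE y; have s1 := cos_le1 y.
eexists; first by repeat derive_dbl_rule hy; rewrite /= ?expf_neq0 ?mulf_neq0.
rewrite [leRHS](_ : _ = 4 * ((1 - cos_dbl y) * (1 + cos_dbl y))
  / cos_dbl y) /=; last by field.
have c1 : cos_dbl y <= 1 by rewrite cE; nra.
rewrite divr_ge0 ?mulr_ge0 ?subr_ge0 // ?ltW //; lra.
Qed.

(** Up to the factor [6 * cos_dbl x], this is the derivative of 2 K0 + 4 Delta - 6 I for the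
    normalized summands. *)
Lemma logratio_le_K0_Delta_bound x : 0 <= x < pi / 4 ->
  0 <= sin_dbl x / 3 * ((cos_dbl x)^-1 ^+ 3 + (cos_dbl x)^-1 + 4) - logratio x.
Proof.
move: x; apply: nonneg_of_derive => [|y hy].
  by rewrite !at0; field.
have [s0 r0 d0 c0] := quarter_angle_bounds hy.
have cn := lt0r_neq0 c0; have sn := lt0r_neq0 s0.
have r2 := sin2cos2 y; have cE := cos_dblE y; have s1 := cos_le1 y.
eexists; first by repeat derive_dbl_rule hy; rewrite /= ?expf_neq0 ?mulf_neq0.
have uE := sin_dbl_sqr y.
rewrite [leRHS](_ : _ = 2 / 3 * ((1 - cos_dbl y) ^+ 2 *
  (4 * cos_dbl y ^+ 3 + 8 * cos_dbl y ^+ 2 + 6 * cos_dbl y + 3))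
  / cos_dbl y ^+ 4) /=; last by field: uE.
(* The cubic factor has positive coefficients, so positivity of [cos_dbl y] suffices. *)
move: (cos_dbl y) c0 => c c0.
have c1 := ltW c0.
rewrite divr_ge0 ?exprn_ge0 // mulr_ge0 ?divr_ge0 // mulr_ge0 ?sqr_ge0 //.
by rewrite !addr_ge0 ?mulr_ge0 ?exprn_ge0.
Qed.

(** Up to the factor [cos_dbl x], this is the derivative of K0 + 15 I - 16 M1 for the normalized
    summands. *)
Lemma logratio_ge_M1_K0_bound x : 0 <= x < pi / 4 ->
  0 <= 15 * logratio x - (64 * (sin x * (2 * cos x - 1)) / cos_dbl x
    - sin_dbl x * ((cos_dbl x)^-1 ^+ 3 + (cos_dbl x)^-1)).
Proof.
move: x; apply: nonneg_of_derive => [|y hy].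
  by rewrite !at0; field.
have [s0 r0 d0 c0] := quarter_angle_bounds hy.
have cn := lt0r_neq0 c0; have sn := lt0r_neq0 s0.
have r2 := sin2cos2 y; have cE := cos_dblE y; have s1 := cos_le1 y.
eexists; first by repeat derive_dbl_rule hy; rewrite /= ?expf_neq0 ?mulf_neq0.
rewrite [leRHS](_ : _ = 2 * ((1 - cos y) ^+ 3 * (256 * cos y ^+ 4
  + 528 * cos y ^+ 3 + 176 * cos y ^+ 2 - 180 * cos y - 92))
  / cos_dbl y ^+ 4) /=; last by rewrite /sin_dbl; field: r2 cE.
(* The quartic would be negative at cos y = 0; it is positive here because [0 < cos_dbl y] forces
   cos y ^+ 2 > 1/2. *)
rewrite divr_ge0 ?mulr_ge0 ?exprn_ge0 ?subr_ge0 // ?ltW //; nra.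
Qed.

(** Multiplying by sin x cos x gives 2/3 of K0 + 2 h - 3 J, the slack in 2 D_{K0 h} <= 3 D_{K0
    J}. *)
Lemma logratio_le_K0_h_bound x : 0 <= x < pi / 4 ->
  0 <= 2 / 3 * (sin x / cos x * ((cos_dbl x)^-1 + 5)) - logratio x.
Proof.
move: x; apply: nonneg_of_derive => [|y hy].
  by rewrite !at0; field.
have [s0 r0 d0 c0] := quarter_angle_bounds hy.
have cn := lt0r_neq0 c0; have sn := lt0r_neq0 s0.
have r2 := sin2cos2 y; have cE := cos_dblE y; have s1 := cos_le1 y.
eexists; first by repeat derive_dbl_rule hy; rewrite /= ?expf_neq0 ?mulf_neq0.
rewrite [leRHS](_ : _ = 2 / 3 * (1 - cos_dbl y) ^+ 2
  / (cos_dbl y ^+ 2 * cos y ^+ 2)) /=; last first.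
  by rewrite /sin_dbl; field: r2 cE; rewrite cn sn.
by rewrite divr_ge0 // mulr_ge0 ?sqr_ge0 ?divr_ge0.
Qed.

End LogRatioBounds.

(** * One-variable profiles of the divergences *)

Section QuarterAngleProfiles.
Variable R : realType.
Implicit Types x y p q : R.

Lemma has_deriv_ln_cos_dbl x : 0 <= x < pi / 4 ->
  has_deriv (fun y => ln (cos_dbl y)) x (- (2 * sin_dbl x / cos_dbl x)).
Proof.
move=> /quarter_angle_bounds[_ _ _ c0].
apply: (has_deriv_eq (has_deriv_ln c0 (has_deriv_cos_dbl x))).
by field; exact: lt0r_neq0.
Qed.

Definition js_profile x : R := sin_dbl x * logratio x / 2 + ln (cos_dbl x).

(** The term [sin_dbl x * (4 / cos_dbl x) / 2] cancels the derivative of [ln (cos_dbl x)]. *)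
Lemma has_deriv_js_profile x : 0 <= x < pi / 4 ->
  has_deriv js_profile x (cos_dbl x * logratio x).
Proof.
move=> hx; have [_ _ _ c0] := quarter_angle_bounds hx.
apply: has_deriv_eq.
  rewrite /js_profile; apply: has_derivD (has_deriv_ln_cos_dbl hx).
  by repeat derive_dbl_rule hx.
by rewrite /=; field; exact: lt0r_neq0.
Qed.

Lemma js_profile0 : js_profile 0 = 0.
Proof. by rewrite /js_profile !at0 ln1; ring. Qed.

Ltac derive_profile_rule hy := first
  [ exact: (has_deriv_js_profile hy) | exact: (has_deriv_ln_cos_dbl hy)
  | derive_dbl_rule hy ].

Lemma J_profile_le_T x : 0 <= x < pi / 4 ->
  0 <= - ln (cos_dbl x) - sin_dbl x * logratio x / 4.
Proof.
move: x; apply: nonneg_of_derive => [|y hy].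
  by rewrite !at0 ln1; ring.
have [s0 r0 d0 c0] := quarter_angle_bounds hy.
eexists; first by repeat derive_profile_rule hy.
rewrite [leRHS](_ : _ = cos_dbl y / 2
  * (2 * sin_dbl y / cos_dbl y ^+ 2 - logratio y)) /=; last first.
  by field; exact: lt0r_neq0.
by rewrite mulr_ge0 ?logratio_le_T_bound // divr_ge0 // ltW.
Qed.

Lemma js_profile_le_M1 x : 0 <= x < pi / 4 ->
  0 <= 4 * (cos x - cos x ^+ 2) - js_profile x.
Proof.
move: x; apply: nonneg_of_derive => [|y hy].
  by rewrite js_profile0 cos0; ring.
have [s0 r0 d0 c0] := quarter_angle_bounds hy.
eexists; first by repeat derive_profile_rule hy.
rewrite [leRHS](_ : _ = cos_dbl y
  * (4 * (sin y * (2 * cos y - 1)) / cos_dbl y - logratio y)) /=; last first.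
  by field; exact: lt0r_neq0.
by rewrite mulr_ge0 ?logratio_le_M1_bound // ltW.
Qed.

Lemma js_profile_ge_Delta x : 0 <= x < pi / 4 ->
  0 <= js_profile x - sin_dbl x ^+ 2 / 2.
Proof.
move: x; apply: nonneg_of_derive => [|y hy].
  by rewrite js_profile0 sin_dbl0; ring.
have [s0 r0 d0 c0] := quarter_angle_bounds hy.
eexists; first by repeat derive_profile_rule hy.
rewrite [leRHS](_ : _ = cos_dbl y * (logratio y - 2 * sin_dbl y)) /=; last first.
  by field.
by rewrite mulr_ge0 ?logratio_ge_Delta_bound // ltW.
Qed.

(** Four times the slack in D_{K0 Delta} <= 3/2 D_{K0 I}. *)
Lemma js_profile_le_K0_Delta x : 0 <= x < pi / 4 ->
  0 <= (cos_dbl x)^-1 - cos_dbl x + 2 * (1 - cos_dbl x ^+ 2) - 6 * js_profile x.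
Proof.
move: x; apply: nonneg_of_derive => [|y hy].
  by rewrite js_profile0 cos_dbl0; field.
have [s0 r0 d0 c0] := quarter_angle_bounds hy.
have cn := lt0r_neq0 c0.
eexists; first by repeat derive_profile_rule hy.
rewrite [leRHS](_ : _ = 6 * (cos_dbl y * (sin_dbl y / 3
  * ((cos_dbl y)^-1 ^+ 3 + (cos_dbl y)^-1 + 4) - logratio y))) /=; last by field.
by rewrite !mulr_ge0 ?logratio_le_K0_Delta_bound // ltW.
Qed.

(** Ten times the slack in 3/2 D_{K0 I} <= 8/5 D_{K0 M1}. *)
Lemma js_profile_ge_M1_K0 x : 0 <= x < pi / 4 ->
  0 <= 15 * js_profile x + ((cos_dbl x)^-1 - cos_dbl x) / 2
    - 64 * (cos x - cos x ^+ 2).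
Proof.
move: x; apply: nonneg_of_derive => [|y hy].
  by rewrite js_profile0 cos_dbl0 cos0; field.
have [s0 r0 d0 c0] := quarter_angle_bounds hy.
have cn := lt0r_neq0 c0.
eexists; first by repeat derive_profile_rule hy.
rewrite [leRHS](_ : _ = cos_dbl y * (15 * logratio y
  - (64 * (sin y * (2 * cos y - 1)) / cos_dbl y
  - sin_dbl y * ((cos_dbl y)^-1 ^+ 3 + (cos_dbl y)^-1)))) /=; last by field.
by rewrite mulr_ge0 ?logratio_ge_M1_K0_bound // ltW.
Qed.

(* The value of each normalized summand at p = (cos x + sin x)^2 and
   q = (cos x - sin x)^2. *)
Definition profile (A : divergence_symbol) x : R :=
  match A with
  | sDelta => sin_dbl x ^+ 2 / 2
  | sI => js_profile x
  | sM1 => 4 * (cos x - cos x ^+ 2)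
  | sM2 => 4 / 3 * (cos x - cos_dbl x)
  | sh => 1 - cos_dbl x
  | sM3 => 4 * (1 - cos x)
  | sJ => sin_dbl x * logratio x / 4
  | sT => - ln (cos_dbl x)
  | sK0 => ((cos_dbl x)^-1 - cos_dbl x) / 2
  end.

(** K0 cancels in the unscaled chain. Once [sin_dbl x ^+ 2] is eliminated, every link is a linear
    consequence of the collected inequalities. *)
Lemma profile_inequalities x : 0 <= x < pi / 4 ->
  let D B := profile sK0 x - profile B x in
  [/\ D sT <= D sJ, D sJ <= D sM3 & D sM3 <= D sh] /\
  [/\ D sh <= D sM2, D sM2 <= D sM1, D sM1 <= D sI & D sI <= D sDelta] /\
  [/\ D sDelta <= 3 / 2 * D sI,
      3 / 2 * D sI <= 8 / 5 * D sM1,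
      8 / 5 * D sM1 <= 24 / 13 * D sM2
    & 24 / 13 * D sM2 <= 2 * D sh] /\
  2 * D sh <= 3 * D sJ /\
  2 * D sh <= 8 / 3 * D sM3.
Proof.
move=> hx; have [s0 r0 d0 c0] := quarter_angle_bounds hx.
have c2E := cos_dblE x; have s1 := cos_le1 x; have r2 := sin2cos2 x.
have u2 := sin_dbl_sqr x.
have cn := lt0r_neq0 c0; have sn := lt0r_neq0 s0.
have T_J := J_profile_le_T hx.
have I_M1 := js_profile_le_M1 hx.
have I_Delta := js_profile_ge_Delta hx.
have I_K0_Delta := js_profile_le_K0_Delta hx.
have I_M1_K0 := js_profile_ge_M1_K0 hx.
have J_M3 : 0 <= sin_dbl x * logratio x / 4 - 4 * (1 - cos x).
  have h := mulr_ge0 (mulr_ge0 r0 (ltW s0)) (logratio_ge_M3_bound hx).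
  have e : sin x * cos x * (logratio x - 8 * (sin x / (cos x * (1 + cos x))))
     = sin_dbl x * logratio x / 2 - 8 * (1 - cos x).
    by rewrite /sin_dbl; field: r2; rewrite sn gt_eqF // addr_gt0.
  by move: h; rewrite e; lra.
have J_K0 : 0 <= ((cos_dbl x)^-1 - cos_dbl x) / 2 + 2 * (1 - cos_dbl x)
    - 3 / 4 * (sin_dbl x * logratio x).
  have h := mulr_ge0 (mulr_ge0 r0 (ltW s0)) (logratio_le_K0_h_bound hx).
  have e : sin x * cos x
       * (2 / 3 * (sin x / cos x * ((cos_dbl x)^-1 + 5)) - logratio x)
     = 1 / 3 * ((cos_dbl x)^-1 - cos_dbl x + 4 * (1 - cos_dbl x))
       - sin_dbl x * logratio x / 2.
    by rewrite /sin_dbl; field: r2 c2E; rewrite sn cn.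
  by move: h; rewrite e; lra.
(* Since c = 2 cos^2 x - 1, the comparisons of M1 with M2, M2 with h and h with
   M3 in the scaled chain are all this one inequality. *)
have alg : 0 <= ((cos_dbl x)^-1 - cos_dbl x) / 2 + 3 * (1 - cos_dbl x)
    - 16 * (1 - cos x).
  rewrite [leRHS](_ : _ = (1 - cos x) ^+ 3 * (10 + 14 * cos x) / cos_dbl x).
    2: by field: c2E.
  apply: divr_ge0 (ltW c0); apply: mulr_ge0; last by lra.
  by rewrite exprn_ge0 // subr_ge0.
(* By c = 2 cos^2 x - 1, each of M1 <= M2, M2 <= h and h <= M3 is a positive multiple of this
   square. *)
have sqr : 0 <= cos x ^+ 2 - 2 * cos x + 1.
  by rewrite [leRHS](_ : _ = (cos x - 1) ^+ 2) ?sqr_ge0 //; ring.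
rewrite /= u2; rewrite u2 in I_Delta; do ![split]; lra.
Qed.

(** * From divergences to profiles, summand by summand *)

Definition summand (A : divergence_symbol) p q : R :=
  match A with
  | sDelta => 1 / 4 * ((p - q) ^+ 2 / (p + q))
  | sI => 2^-1 * (p * ln (2 * p / (p + q)) + q * ln (2 * q / (p + q)))
  | sM1 => 4 * (Num.sqrt ((p + q) / 2) * ((Num.sqrt p + Num.sqrt q) / 2)
     - ((Num.sqrt p + Num.sqrt q) / 2) ^+ 2)
  | sM2 => 4 / 3 * ((Num.sqrt p + Num.sqrt q) / 2 * Num.sqrt ((p + q) / 2)
     - Num.sqrt (p * q))
  | sh => 2^-1 * (Num.sqrt p - Num.sqrt q) ^+ 2
  | sM3 => 4 * ((p + q) / 2
     - (Num.sqrt p + Num.sqrt q) / 2 * Num.sqrt ((p + q) / 2))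
  | sJ => 1 / 8 * ((p - q) * ln (p / q))
  | sT => (p + q) / 2 * ln ((p + q) / (2 * Num.sqrt (p * q)))
  | sK0 => 1 / 8 * ((p - q) ^+ 2 / Num.sqrt (p * q))
  end.

Lemma normalized_sum n A (P Q : 'I_n -> R) :
  normalized A P Q = \sum_(i < n) summand A (P i) (Q i).
Proof. by case: A; rewrite /= -?mulr_sumr // big_split. Qed.

Lemma summandC A p q : 0 < p -> 0 < q -> summand A p q = summand A q p.
Proof.
move=> p0 q0; case: A => /=; rewrite ?(addrC q p) ?(mulrC q p)
  ?(addrC (Num.sqrt q) (Num.sqrt p)) //; try by congr (_ * _); ring.
by rewrite -[q / p]invf_div lnV ?posrE ?divr_gt0 //; ring.
Qed.

(** With u = (p - q) / (p + q) and x = asin u / 2, sin 2x = u, hence p = m (1 + sin 2x) = m (cos x +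
    sin x)^2 and likewise for q; homogeneity pulls out the mean m. Here q <= p gives 0 <= x, and 0 <
    q gives x < pi / 4. *)
Lemma summand_profile_le p q : 0 < q -> q <= p ->
  exists2 x, 0 <= x < pi / 4 &
    forall A, summand A p q = (p + q) / 2 * profile A x.
Proof.
move=> q0 qp; have p0 : 0 < p by exact: lt_le_trans qp.
set m := (p + q) / 2; have m0 : 0 < m by rewrite divr_gt0 ?addr_gt0.
pose u := (p - q) / (p + q).
have pq0 : 0 < p + q by rewrite addr_gt0.
have u0 : 0 <= u by rewrite divr_ge0 ?subr_ge0 // ltW.
have u1 : u < 1 by rewrite ltr_pdivrMr // mul1r ltrBlDr -addrA ltrDl addr_gt0.
have um : -1 <= u by lra.
pose x := asin u / 2.
have hx : 0 <= x < pi / 4.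
  have h1 : asin u < pi / 2 by apply: asin_ltpi2; rewrite um u1.
  have h0 : 0 <= asin u.
    (* A negative [asin u] would make its sine u negative. *)
    rewrite leNgt; apply/negP => h; have := u0; rewrite leNgt => /negP; apply.
    rewrite -(@asinK R u) ?in_itv /= ?um ?ltW // -oppr_gt0 -sinN.
    have hm : - (pi / 2) <= asin u by apply: asin_geNpi2; rewrite um ltW.
    have pi0 := pi_gt0 R.
    by apply: sin_gt0_pi; rewrite oppr_gt0 h /=; lra.
  by rewrite /x; apply/andP; split; lra.
exists x => //.
have [s0 r0 d0 c0] := quarter_angle_bounds hx.
have a0 : 0 < cos x + sin x by rewrite ltr_wpDr.
have uE : sin_dbl x = u.
  have <- : sin (asin u) = u by apply: asinK; rewrite in_itv /= um ltW.
  have -> : asin u = x *+ 2 by rewrite /x -mulr_natr; field.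
  by rewrite sin_mulr2n /sin_dbl -mulr_natr; ring.
have r2 := sin2cos2 x.
have pE : p = m * (cos x + sin x) ^+ 2.
  have -> : (cos x + sin x) ^+ 2 = 1 + u by rewrite -uE /sin_dbl; ring: r2.
  by rewrite /m /u; field; exact: lt0r_neq0.
have qE : q = m * (cos x - sin x) ^+ 2.
  have -> : (cos x - sin x) ^+ 2 = 1 - u by rewrite -uE /sin_dbl; ring: r2.
  by rewrite /m /u; field; exact: lt0r_neq0.
have pqE : p + q = 2 * m by rewrite /m; field.
have pmqE : p - q = 2 * m * sin_dbl x.
  by rewrite uE /m /u; field; exact: lt0r_neq0.
pose k := Num.sqrt m; have kk : k ^+ 2 = m by rewrite sqr_sqrtr // ltW.
have k0 : 0 < k by rewrite sqrtr_gt0.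
have sp : Num.sqrt p = k * (cos x + sin x).
  by rewrite pE sqrtrM ?ltW // sqrtr_sqr gtr0_norm.
have sq : Num.sqrt q = k * (cos x - sin x).
  by rewrite qE sqrtrM ?ltW // sqrtr_sqr gtr0_norm.
have spq : Num.sqrt (p * q) = m * cos_dbl x.
  by rewrite sqrtrM ?ltW // sp sq -kk /cos_dbl; ring.
have cE : cos_dbl x = (cos x + sin x) * (cos x - sin x).
  by rewrite /cos_dbl; ring.
have lc : ln (cos_dbl x) = ln (cos x + sin x) + ln (cos x - sin x).
  by rewrite cE lnM ?posrE.
have u2 := sin_dbl_sqr x; have c2E := cos_dblE x.
have mn := lt0r_neq0 m0; have cn := lt0r_neq0 c0; have an := lt0r_neq0 a0.
have dn := lt0r_neq0 d0.
have ap : (cos x + sin x) ^+ 2 = 1 + sin_dbl x by rewrite /sin_dbl; ring: r2.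
have dp : (cos x - sin x) ^+ 2 = 1 - sin_dbl x by rewrite /sin_dbl; ring: r2.
have lsqr (y : R) : 0 < y -> ln (y ^+ 2) = 2 * ln y.
  by move=> y0; rewrite lnXn // mulr_natl.
case=> /=; rewrite ?spq -?/m -?/k ?pmqE ?pqE ?sp ?sq.
- by field.
- have -> : 2 * p / (2 * m) = (cos x + sin x) ^+ 2 by rewrite [in LHS]pE; field.
  have -> : 2 * q / (2 * m) = (cos x - sin x) ^+ 2 by rewrite [in LHS]qE; field.
  rewrite !lsqr // /js_profile lc /logratio [in LHS]pE [in LHS]qE ap dp.
  by field.
- by rewrite -kk; field.
- by rewrite -kk; field.
- by rewrite -kk c2E; field: r2.
- by rewrite -kk; field.
- have -> : p / q = ((cos x + sin x) / (cos x - sin x)) ^+ 2.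
    by rewrite pE qE; field; rewrite mn dn.
  by rewrite lsqr ?divr_gt0 // ln_div ?posrE // /logratio; field.
- have -> : 2 * m / (2 * (m * cos_dbl x)) = (cos_dbl x)^-1.
    by field; rewrite mn cn.
  by rewrite lnV ?posrE //; ring.
- by field: u2; rewrite mn cn.
Qed.

Lemma summand_profile p q : 0 < p -> 0 < q ->
  exists2 x, 0 <= x < pi / 4 &
    forall A, summand A p q = (p + q) / 2 * profile A x.
Proof.
move=> p0 q0; have [qp|/ltW pq] := leP q p; first exact: summand_profile_le.
have [x hx e] := summand_profile_le p0 pq.
by exists x => // A; rewrite summandC // e addrC.
Qed.

(** Each index has its own angle x, so a profile inequality valid for all x is summed with the
    positive weights (P i + Q i) / 2. *)
Lemma divergence_diff_le n (P Q : 'I_n -> R) (k l : R) B C :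
  (forall i, 0 < P i) -> (forall i, 0 < Q i) ->
  (forall x, 0 <= x < pi / 4 ->
    k * (profile sK0 x - profile B x) <= l * (profile sK0 x - profile C x)) ->
  k * divergence_diff sK0 B P Q <= l * divergence_diff sK0 C P Q.
Proof.
move=> P0 Q0 h; rewrite /divergence_diff !normalized_sum -!sumrB !mulr_sumr.
apply: ler_sum => i _; have [x hx e] := summand_profile (P0 i) (Q0 i).
rewrite !e -!mulrBr mulrCA [leRHS]mulrCA ler_pM2l ?h //.
by rewrite divr_gt0 ?addr_gt0.
Qed.

End QuarterAngleProfiles.

Theorem mainTheorem4 (R : realType) (n : nat) (n_ge2 : (2 <= n)%N)
    (P Q : 'I_n -> R)
    (hP : positive_distribution P) (hQ : positive_distribution Q) :
  let D B := divergence_diff sK0 B P Q in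
  [/\ D sT <= D sJ, D sJ <= D sM3 & D sM3 <= D sh] /\
  [/\ D sh <= D sM2, D sM2 <= D sM1, D sM1 <= D sI & D sI <= D sDelta] /\
  [/\ D sDelta <= 3 / 2 * D sI,
      3 / 2 * D sI <= 8 / 5 * D sM1,
      8 / 5 * D sM1 <= 24 / 13 * D sM2
    & 24 / 13 * D sM2 <= 2 * D sh] /\
  2 * D sh <= 3 * D sJ /\
  2 * D sh <= 8 / 3 * D sM3.
Proof.
move: hP hQ => [P0 _] [Q0 _] D.
have scaled k l B C := @divergence_diff_le R n P Q k l B C P0 Q0.
(* Some links have coefficient 1 on both sides or on the left only; these variants insert it so that
   [scaled] applies. *)
have le1 B C : (forall x : R, 0 <= x < pi / 4 ->
    profile sK0 x - profile B x <= profile sK0 x - profile C x) -> D B <= D C.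
  move=> h; rewrite -[D B]mul1r -[D C]mul1r; apply: scaled => x hx.
  by rewrite !mul1r; exact: h.
have le1l l B C : (forall x : R, 0 <= x < pi / 4 ->
    profile sK0 x - profile B x <= l * (profile sK0 x - profile C x)) ->
    D B <= l * D C.
  move=> h; rewrite -[D B]mul1r; apply: scaled => x hx.
  by rewrite !mul1r; exact: h.
do ![split]; (apply: le1 || apply: le1l || apply: scaled)
  => x /profile_inequalities; by case=> -[? ? ?] [[? ? ? ?] [[? ? ? ?] [? ?]]].
Qed.
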